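(* Let $f_1,f_2\in L_2(\Omega)$ satisfy $f_1\le f_2$ in $\Omega$, and let $\psi_a\in\mathbb R$. For $i=1,2$ let $u_i\in\mathcal V_{0,b}$ be a solution of $$(\kappa(x,u_i)u_i',v')=(f_i,v)+\psi_a v(a)\quad\text{for all } v\in\mathcal V_{0,b}.$$ If $$\max_{0\le k\le n-1}|u_2(a_k)-u_2(a_{k+1})|<\frac{2k_\alpha}{L_0},$$ then $u_1\le u_2$ in $\Omega$.
   Context: $\Omega=(a,b)\subset\mathbb R$ is a bounded open interval with a subdivision $a=a_0<a_1<\dots<a_{n-1}<a_n=b$, not assumed uniform. $\mathcal V_{0,b}$ is the space of continuous functions on $[a,b]$ that are affine on each interval $(a_{k-1},a_k)$, $k=1,\dots,n$, and satisfy $v(b)=0$ (no condition at $a$). Here $(u,v)=\int_\Omega uv$ and $v'=\mathrm dv/\mathrm dx$. The coefficient $\kappa:\Omega\times\mathbb R\to\mathbb R$ is a Carathéodory function (measurable in $x$ for each $s$, continuous in $s$ for a.e. $x$). There are constants $0<k_\alpha<k_\beta$ with $k_\alpha<\kappa(x,s)<k_\beta$ for all $s\in\mathbb R$ and a.e. $x\in\Omega$, and a constant $L_0>0$ with $|\kappa(x,s)-\kappa(x,t)|\le L_0|s-t|$ for all $s,t\in\mathbb R$ and a.e. $x\in\Omega$. The discrete equation is the finite element weak form of $-(\kappa(x,u)u')'=f$ in $\Omega$ with a homogeneous Dirichlet condition at $b$ and a Neumann condition at $a$ with datum $\psi_a$. *)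

(* Defs.v *)
From HB Require Import structures.
From mathcomp Require Import all_boot all_order all_algebra.
From mathcomp Require Import all_classical all_reals all_analysis.

Set Implicit Arguments.
Unset Strict Implicit.
Unset Printing Implicit Defensive.

Import Order.TTheory GRing.Theory Num.Theory.
Import numFieldNormedType.Exports.

Local Open Scope classical_set_scope.
Local Open Scope ring_scope.

(* The carrier of [completed_lebesgue_measure]: R with its Lebesgue-measurable
   sets. The canonical sigma-algebra on R is only the Borel one; over it,
   x |-> kappa x (u x) need not be measurable when kappa x is continuous for
   almost every x only. *)
Notation lebesgueTypeR R :=
  (caratheodory_type (measure_extension.mu_ext
    (@lebesgue_stieltjes_measure.wlength R idfun))).

(* Functions on Omega = ]a, b[, or on [a, b], are represented by total functions
   R -> R whose values elsewhere are irrelevant. *)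
Section finite_elements.
Context {R : realType}.
Implicit Types (a b : R) (s : seq R) (f g u v : R -> R) (kappa : R -> R -> R).

Local Notation mu := (@completed_lebesgue_measure R).

Definition lebesgue_measurable_fun (D : set R) f :=
  measurable_fun (D : set (lebesgueTypeR R)) (f : lebesgueTypeR R -> R).

(* f is extended by 0 outside D. *)
Definition in_L2 (D : set R) f :=
  (f \_ D : lebesgueTypeR R -> R) \in Lfun mu 2%:E.

Definition ae_in (D : set R) (P : R -> Prop) := {ae mu, forall x, D x -> P x}.

Definition inner a b f g : R := \int[mu]_(x in `]a, b[) (f x * g x).

(* A subdivision a = a_0 < ... < a_n = b is given by s = [:: a_1; ...; a_n] with
   [itv_partition a b s], so that n = size s. *)
Definition node a b s (k : nat) : R := nth b (a :: s) k.

Definition affine_on (D : set R) v :=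
  exists c d : R, forall x, D x -> v x = c * x + d.

Definition fe_space a b s : set (R -> R) :=
  [set v | [/\ {within `[a, b], continuous v},
      forall k, (k < size s)%N ->
        affine_on `]node a b s k, node a b s k.+1[ v
    & v b = 0]].

Definition caratheodory_function (D : set R) kappa :=
  (forall t, lebesgue_measurable_fun D (kappa ^~ t)) /\
  ae_in D (fun x => continuous (kappa x)).

(* The derivative of an element of [fe_space] exists except possibly at the
   nodes, a null set on which the value of [derive1] does not matter. *)
Definition discrete_solution a b s kappa f (psi : R) u :=
  fe_space a b s u /\
  forall v, fe_space a b s v ->
    inner a b (fun x => kappa x (u x) * derive1 u x) (derive1 v) =
    inner a b f v + psi * v a.

End finite_elements.

(* Main.v *)
Require Import Defs.
From mathcomp Require Import all_boot all_order all_algebra.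
From mathcomp Require Import all_classical all_reals all_analysis.
From mathcomp Require Import measurable_realfun lra ring.
Import Order.TTheory GRing.Theory Num.Theory.
Import numFieldNormedType.Exports.
Local Open Scope classical_set_scope.
Local Open Scope ring_scope.

(* In one dimension the comparison can be proved one element at a time, from b
   back to a. Testing with the function that is 1 on [a, p], 0 on [q, b] and
   affine in between, where ]p, q[ is an element, isolates the flux through that
   element: if c_i is the slope of u_i there and K_i is the integral of
   kappa(x, u_i(x)) over ]p, q[, then f1 <= f2 gives c_2 K_2 <= c_1 K_1.

   Assume u1(q) <= u2(q) but u1(p) > u2(p), and put P = (u1 - u2)(p) > 0,
   Q = (u2 - u1)(q) >= 0 and h = q - p, so that h (c_2 - c_1) = P + Q. The
   affine function u2 - u1 takes the values -P and Q at p and q, so its absolute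
   value is at most the affine interpolant of P and Q, whose integral is
   h (P + Q) / 2. Hence
     (c_2 - c_1) k_alpha h <= (c_2 - c_1) K_1 <= |c_2| |K_2 - K_1|
                           <= |c_2| L0 h (P + Q) / 2,
   that is |u2(p) - u2(q)| = |c_2| h >= 2 k_alpha / L0. *)

Set Implicit Arguments.
Unset Strict Implicit.

(** * Measurability and integration for the completed Lebesgue measure *)

Lemma borel_lebesgue_measurable (R : realType) (D : set R) :
  measurable D -> measurable (D : set (lebesgueTypeR R)).
Proof. by move=> mD; exact: sub_caratheodory. Qed.

Lemma borel_lebesgue_measurable_fun (R : realType) (D : set R) (f : R -> R) :
  measurable D -> measurable_fun D f -> lebesgue_measurable_fun D f.
Proof.
move=> mD mf _ Y mY; apply: borel_lebesgue_measurable; exact: mf.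
Qed.

Lemma completed_lebesgue_measure_oo (R : realType) (p q : R) : p <= q ->
  completed_lebesgue_measure (`]p, q[%classic : set (lebesgueTypeR R)) =
  (q - p)%:E.
Proof.
move=> pq; have /= := @lebesgue_measure_itv R `]p, q[.
rewrite lte_fin; case: ifPn => // /negPf qp.
have -> : q = p by apply: le_anti; rewrite pq andbT leNgt qp.
by rewrite subrr.
Qed.

Lemma completed_lebesgue_measure_set1 (R : realType) (p : R) :
  completed_lebesgue_measure ([set p] : set (lebesgueTypeR R)) = 0%E.
Proof. exact: (@lebesgue_measure_set1 R p). Qed.

(* The identity from the completed to the Borel Lebesgue space pushes the
   completed measure forward to the Lebesgue measure. *)
Lemma ge0_integral_completed (R : realType) (D : set R) (f : R -> \bar R) :
  measurable D -> measurable_fun D f -> (forall x, D x -> 0 <= f x)%E ->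
  (\int[@completed_lebesgue_measure R]_(x in (D : set (lebesgueTypeR R))) f x =
   \int[@lebesgue_measure R]_(x in D) f x)%E.
Proof.
move=> mD mf f0.
have mid : measurable_fun setT (id : lebesgueTypeR R -> measurableTypeR R).
  by move=> _ Y mY; rewrite setTI; exact: borel_lebesgue_measurable.
rewrite -(@ge0_integral_pushforward _ _ _ _ R _ mid completed_lebesgue_measure
  D f mD)//; last first.
  by move=> x; rewrite inE; exact: f0.
Qed.

Lemma ae_inP (R : realType) (P : R -> Prop) (D : set R) :
  ae_in D P -> exists N : set (lebesgueTypeR R),
  [/\ measurable N, completed_lebesgue_measure N = 0%E &
   forall x, D x -> ~ N x -> P x].
Proof.
move=> [N [mN N0 sN]]; exists N; split => // x Dx Nx.
by apply: contra_notP Nx => Px; apply: sN => /= H; exact: Px (H Dx).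
Qed.

(** The part of a preimage that meets [N] is a subset of a null set, hence measurable by
    completeness; the rest is covered by measurability on the complement. *)
Lemma complete_measurable_fun (R : realType) (D N : set R) (f : R -> R) :
  measurable (N : set (lebesgueTypeR R)) ->
  completed_lebesgue_measure (N : set (lebesgueTypeR R)) = 0%E ->
  lebesgue_measurable_fun (D `\` N) f -> lebesgue_measurable_fun D f.
Proof.
move=> mN N0 mf mD Y mY.
have mDN : measurable (D `\` N : set (lebesgueTypeR R)) by exact: measurableD.
have -> : D `&` f @^-1` Y =
    ((D `\` N) `&` f @^-1` Y) `|` (N `&` D `&` f @^-1` Y).
  by rewrite -setIUl setIC -[in RHS](setIC D) setDE -setIUr setUCl setIT setIC.
apply: measurableU; first exact: mf.
apply: completed_lebesgue_measure_is_complete; exists N; split => //.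
by move=> x [[]].
Qed.

(** Off a null set [kappa x] is continuous, so [kappa x (u x)] is the limit of [kappa x (un n x)].
    Each approximant is pieced together from countably many measurable sections [kappa ^~ t]. *)
Lemma caratheodory_comp_measurable (R : realType) (D : set R)
    (kappa : R -> R -> R) (u : R -> R) :
  measurable (D : set (lebesgueTypeR R)) ->
  caratheodory_function D kappa -> lebesgue_measurable_fun D u ->
  lebesgue_measurable_fun D (fun x => kappa x (u x)).
Proof.
move=> mD [mk /ae_inP[N [mN N0 ck]]] mu; apply: (complete_measurable_fun mN N0).
have mDN : measurable (D `\` N : set (lebesgueTypeR R)) by exact: measurableD.
(* u is approximated by countably-valued functions. *)
pose un n x := (Num.floor (n.+1%:R * u x))%:~R / n.+1%:R : R.
rewrite /lebesgue_measurable_fun.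
apply: (@measurable_fun_cvg _ (lebesgueTypeR R) R _
  (fun n x => kappa x (un n x))) => [n|x [Dx Nx]].
  move=> _ Y mY.
  pose z (i : int) := (i%:~R / n.+1%:R : R).
  (* The approximant [un n] takes the value [z i] exactly where [u] lies in [[z i, z (i + 1)[]. *)
  have -> : (D `\` N) `&` (fun x => kappa x (un n x)) @^-1` Y =
     \bigcup_(i : int) ((D `\` N) `&` ((D `&` u @^-1` `[z i, z (i + 1)[) `&`
        (D `&` (kappa ^~ (z i)) @^-1` Y))).
    apply/seteqP; split => [x /= [[Dx Nx] Yx]|x /= [i _ [[Dx Nx] []]]].
      exists (Num.floor (n.+1%:R * u x)) => //.
      split => //; split => //; split => //=.
      rewrite in_itv/= /z ler_pdivrMr ?ltr_pdivlMr//.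
      by rewrite (mulrC (u x)) floor_itv.
    move=> [_ /=]; rewrite in_itv/= /z ler_pdivrMr ?ltr_pdivlMr// (mulrC (u x)).
    move=> H [_ Yx]; split => //; rewrite /un.
    by rewrite (floor_def H).
  apply: countable_bigcupT_measurable => [|i]; first exact: countableP.
  apply: measurableI => //; apply: measurableI; first exact: mu.
  exact: mk.
apply: (@continuous_cvg _ _ _ _ _ _ (kappa x)); first exact: ck.
apply/cvgrPdist_le => e e0; near=> n.
have n0 : 0 < n.+1%:R :> R by [].
(* Multiplied by [n.+1], the error becomes the fractional part of [n.+1%:R * u x], which is at most
   1, while [n.+1%:R * e] eventually exceeds 1. *)
rewrite /un -(ler_pM2l n0) -{1}(gtr0_norm n0) -normrM mulrBr.
rewrite mulrCA divff ?gt_eqF// mulr1.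
have /andP[l1 l2] := floor_itv (n.+1%:R * u x).
rewrite ger0_norm ?subr_ge0//.
apply: (@le_trans _ _ 1).
  by move: l2; rewrite intrD => /ltW; rewrite lerBlDr addrC.
rewrite mulrC -ler_pdivrMr// ltW// mul1r.
near: n; exact: near_infty_natSinv_lt (PosNum e0).
Unshelve. all: by end_near.
Qed.

(** * Monotonicity of the integral and criteria for integrability *)

Lemma ae_le_Rintegral d (T : measurableType d) (R : realType)
    (mu : {measure set T -> \bar R}) (D : set T) (f g : T -> R) :
  measurable D -> mu.-integrable D (EFin \o f) ->
  mu.-integrable D (EFin \o g) -> {ae mu, forall x, D x -> f x <= g x} ->
  \int[mu]_(x in D) f x <= \int[mu]_(x in D) g x.
Proof.
move=> mD fi gi [N [mN N0 sN]]; rewrite /Rintegral.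
(* Discarding the null set from both integrals leaves an inequality that holds at every remaining
   point. *)
rewrite (negligible_integral mN mD fi N0) (negligible_integral mN mD gi N0).
have mDN : measurable (D `\` N) by exact: measurableD.
apply: le_Rintegral => //.
- by apply: integrableS fi => // x [].
- by apply: integrableS gi => // x [].
move=> x [Dx Nx]; apply: contra_notT Nx => H; apply: sN => /= /(_ Dx).
exact/negP.
Qed.

Lemma ae_bounded_integrable d (T : measurableType d) (R : realType)
    (mu : {measure set T -> \bar R}) (D : set T) (f : T -> R) (M : R) :
  measurable D -> (mu D < +oo)%E -> measurable_fun D f -> 0 <= M ->
  {ae mu, forall x, D x -> `|f x| <= M} -> mu.-integrable D (EFin \o f).
Proof.
move=> mD Doo mf M0 fM; apply/integrableP; split; first exact/measurable_EFinP.
have mf' : measurable_fun D (EFin \o f) by exact/measurable_EFinP.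
apply: (@le_lt_trans _ _ (M%:E * mu D)%E); last by rewrite lte_mul_pinfty.
by apply: integral_le_bound.
Qed.

(** Since [|v| <= 1], the product is dominated by [1 + f ^ 2], which is integrable on a set of
    finite measure. *)
Lemma in_L2_integrable (R : realType) (D : set R) (f v : R -> R) :
  measurable (D : set (lebesgueTypeR R)) ->
  (completed_lebesgue_measure (D : set (lebesgueTypeR R)) < +oo)%E ->
  in_L2 D f -> lebesgue_measurable_fun D v ->
  (forall x, D x -> `|v x| <= 1) ->
  completed_lebesgue_measure.-integrable (D : set (lebesgueTypeR R))
    (EFin \o (fun x => f x * v x)).
Proof.
move=> mD Doo f2 mv v1.
have mf : lebesgue_measurable_fun D f.
  move: f2; rewrite /in_L2 inE => /andP[+ _]; rewrite inE /= => mfD.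
  by apply/(measurable_restrictT _ mD).
have f2i := integrableS measurableT mD (@subsetT _ _) (Lfun2_integrable_sqr f2).
have i1 : completed_lebesgue_measure.-integrable
    (D : set (lebesgueTypeR R)) (EFin \o cst (1 : R)).
  apply: (@ae_bounded_integrable _ _ _ _ _ _ 1) => //.
  by apply: aeW => x _; rewrite normr1.
apply: (le_integrable _ _ _ (integrableD mD i1 f2i)) => //.
  by apply/measurable_EFinP; apply: measurable_funM.
move=> x Dx /=; rewrite lee_fin /patch mem_set// normrM.
have : `|f x| * `|v x| <= `|f x| * 1 by rewrite ler_wpM2l// v1.
rewrite [X in _ -> _ <= X]ger0_norm ?addr_ge0 ?sqr_ge0//.
rewrite -(real_normK (num_real (f x))).
by nra.
Qed.

(** * Affine functions: integral, closure at endpoints, derivative *)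

Lemma continuous_affine (R : realType) (c d : R) :
  continuous (fun x : R => c * x + d).
Proof.
move=> x; apply: (@cvgD _ R^o); last exact: cvg_cst.
by apply: (@cvgM R); [exact: cvg_cst|exact: cvg_id].
Qed.

(** Nonnegativity gives access to [ge0_integral_completed], which moves the integral to the Borel
    measure; the fundamental theorem of calculus then applies on the closed interval, the endpoints
    being null. *)
Lemma Rintegral_affine (R : realType) (p q c d : R) : p < q ->
  (forall x, p < x < q -> 0 <= c * x + d) ->
  \int[@completed_lebesgue_measure R]_(x in
    (`]p, q[%classic : set (lebesgueTypeR R))) (c * x + d) =
  (q - p) * (c * (p + q) / 2 + d).
Proof.
move=> pq pos; have cf := @continuous_affine R c d.
have mf E : measurable_fun E (EFin \o (fun x : R => c * x + d)).
  apply/measurable_EFinP; apply: measurable_funTS.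
  exact: continuous_measurable_fun.
rewrite /Rintegral ge0_integral_completed => [|||x];
  [|exact: measurable_itv|exact: mf|]; last first.
  by rewrite /= in_itv => /pos; rewrite lee_fin.
rewrite integral_itv_obnd_cbnd//.
rewrite integral_itv_bndo_bndc//.
pose F := (fun x => c / 2 * x ^+ 2 + d * x) : R^o -> R^o.
have dF (x : R^o) : is_derive x 1 F (c * x + d).
  rewrite /F; apply: is_derive_eq.
  by rewrite /GRing.scale /=; field.
rewrite (@continuous_FTC2 _ _ F) //.
- by rewrite /F /=; field.
- exact: continuous_subspaceT.
- split => [x _||]; first exact: ex_derive.
  + apply: cvg_at_right_filter; apply: differentiable_continuous.
    exact/derivable1_diffP/ex_derive.
  + apply: cvg_at_left_filter; apply: differentiable_continuous.
    exact/derivable1_diffP/ex_derive.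
- by move=> x _; rewrite derive1E; exact: derive_val.
Qed.

(** At each endpoint [v] and the affine formula have the same one-sided limit, so uniqueness of
    limits identifies their values. *)
Lemma affine_oo_cc (R : realType) (p q c d : R) (v : R -> R) : p < q ->
  {within `[p, q], continuous v} ->
  (forall x, p < x < q -> v x = c * x + d) ->
  forall x, p <= x <= q -> v x = c * x + d.
Proof.
move=> pq /(continuous_within_itvP _ pq)[_ vp vq] vE.
have cf := @continuous_affine R c d.
have vpE : v p = c * p + d.
  apply: (@cvg_unique R^o (@norm_hausdorff R R^o) (v @ p^'+)) => //.
  apply: cvg_trans (cvg_at_right_filter (cf p)); apply: near_eq_cvg.
  by near=> y; rewrite vE//; apply/andP; split; near: y;
    [exact: nbhs_right_gt|exact: nbhs_right_lt].
have vqE : v q = c * q + d.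
  apply: (@cvg_unique R^o (@norm_hausdorff R R^o) (v @ q^'-)) => //.
  apply: cvg_trans (cvg_at_left_filter (cf q)); apply: near_eq_cvg.
  by near=> y; rewrite vE//; apply/andP; split; near: y;
    [exact: nbhs_left_gt|exact: nbhs_left_lt].
move=> x /andP[]; rewrite le_eqVlt => /predU1P[<-//|px].
by rewrite le_eqVlt => /predU1P[->//|xq]; rewrite vE// px.
Unshelve. all: by end_near.
Qed.

Lemma derive1_affine_oo (R : realType) (p q c d x : R) (v : R -> R) :
  p < x < q -> (forall y, p < y < q -> v y = c * y + d) ->
  derive1 v x = c.
Proof.
move=> /andP[px xq] vE; rewrite derive1E.
pose F := (fun x => c * x + d) : R^o -> R^o.
have dF : is_derive (x : R^o) 1 F c.
  rewrite /F; apply: is_derive_eq; rewrite /GRing.scale /=; ring.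
rewrite -[RHS](@derive_val _ _ _ _ _ _ _ dF); apply: near_eq_derive.
by near=> y; rewrite vE//; apply/andP; split; near: y;
  [exact: lt_nbhsr|exact: lt_nbhsl].
Unshelve. all: by end_near.
Qed.

(** * The ramp test functions *)

(** Clamping to [0, 1] the affine function with values 1 at [p] and 0 at [q] makes continuity a
    consequence of that of min and max. *)
Definition ramp (R : realType) (p q x : R) : R :=
  Num.min 1 (Num.max 0 ((q - x) / (q - p))).

Section ramp.
Variables (R : realType) (p q : R).
Hypothesis pq : p < q.

Lemma ramp_left x : x <= p -> ramp p q x = 1.
Proof.
move=> xp; rewrite /ramp min_l// le_max; apply/orP; right.
by rewrite ler_pdivlMr ?subr_gt0// mul1r lerD2l lerN2.
Qed.

Lemma ramp_mid x : p <= x <= q -> ramp p q x = - (q - p)^-1 * x + q / (q - p).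
Proof.
move=> /andP[px xq]; have qp : 0 < q - p by rewrite subr_gt0.
rewrite /ramp max_r ?divr_ge0 ?subr_ge0// ?(ltW pq)// min_r; first by ring.
by rewrite ler_pdivrMr// mul1r lerD2l lerN2.
Qed.

Lemma ramp_right x : q <= x -> ramp p q x = 0.
Proof.
move=> qx; have qp : 0 < q - p by rewrite subr_gt0.
rewrite /ramp max_l ?min_r ?ler01// ler_pdivrMr// mul0r; lra.
Qed.

Lemma ramp_ge0 x : 0 <= ramp p q x.
Proof. by rewrite /ramp le_min ler01 le_max lexx. Qed.

Lemma ramp_le1 x : ramp p q x <= 1.
Proof. by rewrite /ramp ge_min lexx. Qed.

Lemma continuous_ramp : continuous (ramp p q).
Proof.
move=> x; pose l : R -> R^o := fun y => (q - y) / (q - p).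
have cl : {for x, continuous l}.
  apply: (@cvgM R); last exact: cvg_cst.
  by apply: (@cvgB _ R^o); [exact: cvg_cst|exact: cvg_id].
have := @continuous_min R R (cst 1) (cst 0 \max l) x.
by apply; [exact: cvg_cst|apply: continuous_max => //; exact: cvg_cst].
Qed.

Lemma derive1_ramp_left x : x < p -> derive1 (ramp p q) x = 0.
Proof.
(* The left end [x - 1] is arbitrary: any open interval around [x] that stays left of [p] would
   serve. *)
move=> xp; apply: (@derive1_affine_oo _ (x - 1) p _ 1) => [|y /andP[_ yp]].
  by rewrite xp andbT; lra.
by rewrite ramp_left ?mul0r ?add0r// ltW.
Qed.

Lemma derive1_ramp_mid x : p < x < q -> derive1 (ramp p q) x = - (q - p)^-1.
Proof.
move=> pxq; apply: (derive1_affine_oo pxq) => y /andP[py yq].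
by apply: ramp_mid; rewrite !ltW.
Qed.

Lemma derive1_ramp_right x : q < x -> derive1 (ramp p q) x = 0.
Proof.
move=> qx; apply: (@derive1_affine_oo _ q (x + 1) _ 0) => [|y /andP[qy _]].
  by rewrite qx/=; lra.
by rewrite ramp_right ?mul0r ?add0r// ltW.
Qed.

End ramp.

(** * Nodes of the subdivision and the finite element space *)

Section nodes.
Variables (R : realType) (a b : R) (s : seq R).
Hypothesis hs : itv_partition a b s.

Lemma node_size : node a b s (size s) = b.
Proof. exact: itv_partition_nth_size. Qed.

Lemma node_lt i j : (i < j)%N -> (j <= size s)%N ->
  node a b s i < node a b s j.
Proof.
move=> ij js; case: hs => sa _.
apply: (@sorted_ltn_nth R _ lt_trans b (a :: s) sa) => //=; rewrite inE ltnS//.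
by rewrite (leq_trans _ js)// ltnW.
Qed.

Lemma node_le i j : (i <= j)%N -> (j <= size s)%N ->
  node a b s i <= node a b s j.
Proof. by rewrite leq_eqVlt => /predU1P[->//|ij js]; exact/ltW/node_lt. Qed.

Lemma fe_space_ramp k : (k < size s)%N ->
  fe_space a b s (ramp (node a b s k) (node a b s k.+1)).
Proof.
move=> ks; have pq := node_lt (leqnn k.+1) ks.
split.
- exact/continuous_subspaceT/continuous_ramp.
(* Element [j] lies to the left of element [k], to its right, or is element [k] itself; the ramp is
   there constantly 1, constantly 0, or of slope [- (q - p)^-1]. *)
- move=> j js; have [jk|kj|->] := ltngtP j k.
  + exists 0, 1 => x /=; rewrite in_itv/= => /andP[_ xj].
    rewrite ramp_left ?mul0r ?add0r//.
    by rewrite (le_trans (ltW xj))// node_le// ltnW.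
  + exists 0, 0 => x /=; rewrite in_itv/= => /andP[xj _].
    rewrite ramp_right ?mul0r ?add0r//.
    by rewrite (le_trans _ (ltW xj))// node_le// ltnW.
  + eexists; eexists => x /=; rewrite in_itv/= => /andP[xj jx].
    by rewrite (ramp_mid pq)// !ltW.
- by rewrite ramp_right// -{2}node_size node_le.
Qed.

(** Including both nodes in the formula is what allows nodal values to be passed from one element to
    the next. *)
Lemma fe_space_affine v k : (k < size s)%N -> fe_space a b s v ->
  exists c d : R, forall x, node a b s k <= x <= node a b s k.+1 ->
    v x = c * x + d.
Proof.
move=> ks [cv /(_ k ks)[c [d vE]] _]; exists c, d.
apply: affine_oo_cc; first exact: node_lt.
  apply: continuous_subspaceW cv => x /=; rewrite !in_itv/= => /andP[kx xk].
  rewrite (le_trans _ kx) ?(le_trans xk)//.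
    by rewrite -{2}node_size node_le.
  by rewrite -[leLHS]/(node a b s 0) node_le// ltnW.
by move=> x xk; apply: vE; rewrite /= in_itv.
Qed.

End nodes.

(** * Isolating the flux through one element *)

Lemma ae_in_impl (R : realType) (D E : set R) (P Q : R -> Prop) :
  E `<=` D -> (forall x, E x -> P x -> Q x) -> ae_in D P -> ae_in E Q.
Proof.
move=> ED PQ [N [mN N0 sN]]; exists N; split => // x /= EQ; apply: sN => /= DP.
by apply: EQ => Ex; apply: PQ (DP (ED _ Ex)).
Qed.

(** The derivative of the ramp vanishes outside the element and is [- (q - p)^-1] inside, so only
    the flux on []p, q[] survives, with a constant factor. *)
Lemma inner_ramp (R : realType) (a b p q c : R) (g u : R -> R) :
  p < q -> a <= p -> q <= b ->
  (forall x, p < x < q -> derive1 u x = c) ->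
  completed_lebesgue_measure.-integrable
    (`]p, q[%classic : set (lebesgueTypeR R)) (EFin \o g) ->
  inner a b (fun x => g x * derive1 u x) (derive1 (ramp p q)) =
  - (c / (q - p)) *
  \int[completed_lebesgue_measure]_(x in
    (`]p, q[%classic : set (lebesgueTypeR R))) g x.
Proof.
move=> pq ap qb u'c gi; rewrite /inner.
have mi x y : measurable (`]x, y[%classic : set (lebesgueTypeR R)).
  apply: borel_lebesgue_measurable. exact: (@measurable_itv R `]x, y[).
have mset1 x : measurable ([set x] : set (lebesgueTypeR R)).
  by apply: borel_lebesgue_measurable; exact: measurable_set1.
have sub : `]p, q[ `<=` `]a, b[.
  move=> x /=; rewrite !in_itv/= => /andP[px xq].
  by rewrite (le_lt_trans ap)// (lt_le_trans xq).
rewrite -RintegralZl//.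
pose H := (fun x => - (c / (q - p)) * g x) : lebesgueTypeR R -> R.
have mH : measurable_fun (`]p, q[%classic : set (lebesgueTypeR R)) H.
  apply: measurable_funM => //; apply/measurable_EFinP.
  exact: measurable_int gi.
(* The right-hand side becomes an integral over []a, b[] of [H] extended by zero, to be compared
   with the integrand on the left. *)
rewrite -(@setIidr _ `]a, b[ `]p, q[)// (Rintegral_mkcondr _ _ _ H).
have mHr : measurable_fun (`]a, b[%classic : set (lebesgueTypeR R))
    (EFin \o (H \_ `]p, q[)).
  apply/measurable_EFinP; apply/(measurable_restrict _ (mi p q) (mi a b)).
  by rewrite (setIidr sub).
set G : lebesgueTypeR R -> R := fun x => _ * _.
have GH : ae_eq completed_lebesgue_measure
   (`]a, b[%classic : set (lebesgueTypeR R))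
   (EFin \o (H \_ `]p, q[)) (EFin \o G).
  (* The kinks [p] and [q] of the ramp are the only exceptional points. *)
  exists ([set p] `|` [set q]); split.
  - by apply: measurableU; exact: mset1.
  - apply: etrans (completed_lebesgue_measure_set1 p).
    apply: measureU0; [exact: mset1|exact: mset1|].
    exact: completed_lebesgue_measure_set1.
  move=> x /= H1; apply: contra_notP H1 => /not_orP[/eqP xp /eqP xq] _.
  congr EFin; rewrite /G /patch mem_setE in_itv/=.
  have [px|px] := ltP p x => /=; last first.
    by rewrite derive1_ramp_left ?mulr0// lt_neqAle xp.
  have [qx|qx] := ltP x q; last first.
    by rewrite derive1_ramp_right ?mulr0// lt_neqAle eq_sym xq.
  rewrite derive1_ramp_mid ?u'c ?px// /H; ring.
congr fine; apply/esym/ae_eq_integral => //.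
(* Measurability of [G], which involves [derive1 u] on all of []a, b[], is inherited from [H]
   through almost everywhere equality and completeness. *)
apply: ae_measurable_fun GH mHr.
exact: completed_lebesgue_measure_is_complete.
Qed.

Lemma le_inner_L2 (R : realType) (a b : R) (f1 f2 v : R -> R) : a < b ->
  in_L2 `]a, b[ f1 -> in_L2 `]a, b[ f2 ->
  ae_in `]a, b[ (fun x => f1 x <= f2 x) ->
  continuous v -> (forall x, 0 <= v x <= 1) ->
  inner a b f1 v <= inner a b f2 v.
Proof.
move=> ab l1 l2 f12 cv v01; rewrite /inner.
have mD : measurable (`]a, b[%classic : set (lebesgueTypeR R)).
  by apply: borel_lebesgue_measurable; exact: measurable_itv.
have Doo : (completed_lebesgue_measure
    (`]a, b[%classic : set (lebesgueTypeR R)) < +oo)%E.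
  by rewrite completed_lebesgue_measure_oo ?ltW// ltry.
have mv : lebesgue_measurable_fun `]a, b[ v.
  apply: borel_lebesgue_measurable_fun; first exact: measurable_itv.
  by apply: measurable_funTS; exact: continuous_measurable_fun.
have v1 x : `]a, b[%classic x -> `|v x| <= 1.
  by move=> _; have /andP[v0 v1] := v01 x; rewrite ger0_norm.
apply: ae_le_Rintegral => //.
- exact: in_L2_integrable.
- exact: in_L2_integrable.
apply: ae_in_impl f12 => // x _ f12x.
by rewrite ler_wpM2r//; have /andP[] := v01 x.
Qed.

Lemma element_flux_le (R : realType) (a b : R) (s : seq R) (k : nat)
    (kappa : R -> R -> R) (f1 f2 u1 u2 : R -> R) (psi c1 d1 c2 d2 : R) :
  let p := node a b s k in let q := node a b s k.+1 in
  let K u := \int[completed_lebesgue_measure]_(x in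
    (`]p, q[%classic : set (lebesgueTypeR R))) kappa x (u x) in
  a < b -> itv_partition a b s -> (k < size s)%N ->
  in_L2 `]a, b[ f1 -> in_L2 `]a, b[ f2 ->
  ae_in `]a, b[ (fun x => f1 x <= f2 x) ->
  discrete_solution a b s kappa f1 psi u1 ->
  discrete_solution a b s kappa f2 psi u2 ->
  (forall x, p < x < q -> u1 x = c1 * x + d1) ->
  (forall x, p < x < q -> u2 x = c2 * x + d2) ->
  completed_lebesgue_measure.-integrable
    (`]p, q[%classic : set (lebesgueTypeR R))
    (EFin \o (fun x => kappa x (u1 x))) ->
  completed_lebesgue_measure.-integrable
    (`]p, q[%classic : set (lebesgueTypeR R))
    (EFin \o (fun x => kappa x (u2 x))) ->
  c2 * K u2 <= c1 * K u1.
Proof.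
move=> p q K ab hs ks l1 l2 f12 [_ e1] [_ e2] u1E u2E i1 i2.
have pq : p < q by exact: node_lt.
have ap : a <= p by rewrite -[leLHS]/(node a b s 0) node_le// ltnW.
have qb : q <= b by rewrite -[leRHS](node_size hs) node_le.
have F := fe_space_ramp hs ks.
have /e1 := F; have /e2 := F; rewrite -/p -/q.
rewrite (inner_ramp pq ap qb (fun x xpq => derive1_affine_oo xpq u2E) i2).
rewrite (inner_ramp pq ap qb (fun x xpq => derive1_affine_oo xpq u1E) i1).
rewrite -/(K u1) -/(K u2) => E2 E1.
have : inner a b f1 (ramp p q) <= inner a b f2 (ramp p q).
  apply: le_inner_L2 => //; first exact: continuous_ramp.
  by move=> x; rewrite ramp_ge0 ramp_le1.
(* The Neumann term is common to both equations, and the negative slope of the ramp reverses the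
   inequality between the fluxes. *)
rewrite -(lerD2r (psi * ramp p q a)) -E1 -E2 !mulNr lerN2.
by rewrite ![_ / _ * _]mulrAC ler_pM2r// invr_gt0 subr_gt0.
Qed.

(** * Comparison on a single element *)

Section element.
Variables (R : realType) (p q : R) (kappa : R -> R -> R).
Variables (k_alpha k_beta L0 : R).
Hypothesis pq : p < q.
Hypothesis hkappa : caratheodory_function `]p, q[ kappa.
Hypothesis hk_alpha : 0 < k_alpha.
Hypothesis hbounds : ae_in `]p, q[
  (fun x => forall t : R, k_alpha < kappa x t /\ kappa x t < k_beta).
Hypothesis hL0 : 0 < L0.
Hypothesis hlip : ae_in `]p, q[
  (fun x => forall t1 t2 : R, `|kappa x t1 - kappa x t2| <= L0 * `|t1 - t2|).

Local Notation mu := (@completed_lebesgue_measure R).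
Local Notation D := (`]p, q[%classic : set (lebesgueTypeR R)).

Let mD : measurable D.
Proof. by apply: borel_lebesgue_measurable; exact: measurable_itv. Qed.

Let muD : mu D = (q - p)%:E.
Proof. by rewrite completed_lebesgue_measure_oo// ltW. Qed.

Let muDoo : (mu D < +oo)%E.
Proof. by rewrite muD ltry. Qed.

Let affine_measurable (c d : R) :
  lebesgue_measurable_fun D (fun x => c * x + d).
Proof.
apply: borel_lebesgue_measurable_fun; first exact: measurable_itv.
apply: measurable_funTS; apply: continuous_measurable_fun.
exact: continuous_affine.
Qed.

Let affine_integrable (c d : R) :
  mu.-integrable D (EFin \o (fun x => c * x + d)).
Proof.
(* The bound comes from [|x| <= |p| + |q|] for [x] between [p] and [q]. *)
apply: (@ae_bounded_integrable _ _ _ _ _ _ (`|c| * (`|p| + `|q|) + `|d|)) => //.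
  exact: affine_measurable.
apply: aeW => x /=; rewrite in_itv/= => /andP[px xq].
rewrite (le_trans (ler_normD _ _))// lerD2r normrM ler_wpM2l//.
have : x <= `|q| by rewrite (le_trans (ltW xq))// ler_norm.
have : - x <= `|p|.
  by rewrite -normrN (@le_trans _ _ (- p)) ?ler_norm// lerN2 ltW.
rewrite ler_norml; have := normr_ge0 p; have := normr_ge0 q; lra.
Qed.

Lemma kappa_comp_integrable (u : R -> R) (c d : R) :
  (forall x, p < x < q -> u x = c * x + d) ->
  mu.-integrable D (EFin \o (fun x => kappa x (u x))).
Proof.
move=> uE; have mu_ : lebesgue_measurable_fun D u.
  apply: eq_measurable_fun (affine_measurable c d) => x.
  by rewrite inE/= in_itv => /uE.
apply: (@ae_bounded_integrable _ _ _ _ _ _ `|k_beta|) => //.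
  exact: caratheodory_comp_measurable.
apply: ae_in_impl hbounds => // x Dx /(_ (u x)) [k1 k2].
rewrite gtr0_norm ?(lt_trans hk_alpha)//.
by rewrite (le_trans (ltW k2))// ler_norm.
Qed.

Lemma element_comparison (u1 u2 : R -> R) (c1 d1 c2 d2 : R) :
  (forall x, p <= x <= q -> u1 x = c1 * x + d1) ->
  (forall x, p <= x <= q -> u2 x = c2 * x + d2) ->
  c2 * \int[mu]_(x in D) kappa x (u2 x) <=
    c1 * \int[mu]_(x in D) kappa x (u1 x) ->
  `|u2 p - u2 q| < 2 * k_alpha / L0 ->
  u1 q <= u2 q -> u1 p <= u2 p.
Proof.
move=> u1E u2E flux small wq; rewrite leNgt; apply/negP => wp.
have i1 : mu.-integrable D (EFin \o (fun x => kappa x (u1 x))).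
  apply: (@kappa_comp_integrable _ c1 d1) => x /andP[px xq].
  by rewrite u1E// !ltW.
have i2 : mu.-integrable D (EFin \o (fun x => kappa x (u2 x))).
  apply: (@kappa_comp_integrable _ c2 d2) => x /andP[px xq].
  by rewrite u2E// !ltW.
move: flux; set K2 := \int[_]_(x in _) _; set K1 := \int[_]_(x in _) _ => flux.
have h0 : 0 < q - p by rewrite subr_gt0.
set P := u1 p - u2 p; set Q := u2 q - u1 q.
have P0 : 0 < P by rewrite subr_gt0.
have Q0 : 0 <= Q by rewrite subr_ge0.
have PQ : P + Q = (c2 - c1) * (q - p).
  by rewrite /P /Q !u1E ?u2E ?lexx ?ltW//; ring.
have K1_ge : k_alpha * (q - p) <= K1.
  have -> : k_alpha * (q - p) = \int[mu]_(x in D) k_alpha.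
    by rewrite Rintegral_cst// [X in fine X]muD.
  apply: ae_le_Rintegral => //.
    apply: (@ae_bounded_integrable _ _ _ _ _ _ k_alpha) => //; first exact: ltW.
    by apply: aeW => x _; rewrite gtr0_norm.
  by apply: ae_in_impl hbounds => // x Dx /(_ (u1 x)) [/ltW].
(* The function [A * x + B] is the affine interpolant of [P] at [p] and [Q] at [q]. *)
pose A := (Q - P) / (q - p); pose B := (P * q - Q * p) / (q - p).
have bnd x : p < x < q -> `|u2 x - u1 x| <= A * x + B.
  move=> /andP[px xq].
  have -> : A * x + B = (P * (q - x) + Q * (x - p)) / (q - p).
    by rewrite /A /B; field; rewrite gt_eqF.
  have -> : u2 x - u1 x = (Q * (x - p) - P * (q - x)) / (q - p).
    rewrite /P /Q !u1E ?u2E ?lexx ?ltW//; field; by rewrite gt_eqF.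
  rewrite normrM (gtr0_norm (x := _^-1)) ?invr_gt0// ler_pM2r ?invr_gt0//.
  have t1 : 0 <= P * (q - x) by apply: mulr_ge0; rewrite ?subr_ge0 ltW.
  have t2 : 0 <= Q * (x - p) by apply: mulr_ge0; rewrite ?subr_ge0 ?(ltW px).
  rewrite ler_norml; lra.
have K12 : `|K2 - K1| <= L0 * ((q - p) * ((P + Q) / 2)).
  rewrite /K1 /K2 -RintegralB//.
  apply: (le_trans (le_normr_Rintegral _ _)) => //.
    exact: (@integrableB _ _ _ mu D mD _ _ i2 i1).
  (* The interpolant dominates an absolute value by [bnd], which supplies the sign required by
     [Rintegral_affine]. *)
  have -> : (q - p) * ((P + Q) / 2) = \int[mu]_(x in D) (A * x + B).
    rewrite Rintegral_affine//; first by rewrite /A /B; field; rewrite gt_eqF.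
    by move=> x /bnd; exact: le_trans.
  rewrite -RintegralZl//.
  apply: ae_le_Rintegral => //.
  - apply: (@integrable_norm _ _ _ mu D
      (fun x => kappa x (u2 x) - kappa x (u1 x))).
    exact: (@integrableB _ _ _ mu D mD _ _ i2 i1).
  - exact: (@integrableZl _ _ _ mu D mD L0 _ (affine_integrable A B)).
  - apply: ae_in_impl hlip => // x Dx /(_ (u2 x) (u1 x)) kx.
    rewrite (le_trans kx)// ler_pM2l//; apply: bnd.
    by move: Dx; rewrite /= in_itv.
have c2h : `|c2| * (q - p) = `|u2 p - u2 q|.
  rewrite !u2E ?lexx ?ltW// -{1}(gtr0_norm h0) -normrM distrC.
  by congr (`|_|); ring.
(* The flux inequality replaces [c1 * K1] by the smaller [c2 * K2], so the left side is at most
   [c2 * (K1 - K2)]. *)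
have c2K : (c2 - c1) * K1 <= `|c2| * `|K2 - K1|.
  have := ler_norm (c2 * (K1 - K2)); rewrite normrM (distrC K1); lra.
(* It remains to contradict smallness by [2 * k_alpha <= |c2| * (q - p) * L0]. Multiplied by
   [P + Q > 0], with [P + Q] on the left replaced through [PQ], this is twice [E1]. *)
move: small; rewrite -c2h ltr_pdivlMr// ltNge => /negP; apply.
have PQ0 : 0 < P + Q by lra.
have c0 : 0 < c2 - c1 by rewrite -(pmulr_lgt0 _ h0) -PQ.
have E1 : (c2 - c1) * (k_alpha * (q - p)) <=
    `|c2| * (L0 * ((q - p) * ((P + Q) / 2))).
  apply: (le_trans (_ : _ <= (c2 - c1) * K1)); first by rewrite ler_pM2l.
  by rewrite (le_trans c2K)// ler_wpM2l.
rewrite -(ler_pM2l PQ0).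
have -> : (P + Q) * (2 * k_alpha) = 2 * ((c2 - c1) * (k_alpha * (q - p))).
  by rewrite PQ; ring.
have -> : (P + Q) * (`|c2| * (q - p) * L0) =
    2 * (`|c2| * (L0 * ((q - p) * ((P + Q) / 2)))) by field.
by rewrite ler_pM2l.
Qed.

End element.

(** * Propagation of the comparison from element to element *)

Unset Implicit Arguments.

Theorem corollary2p4 (R : realType) (a b : R) (hab : a < b)
  (s : seq R) (hs : itv_partition a b s)
  (kappa : R -> R -> R) (k_alpha k_beta L0 : R)
  (hkappa : caratheodory_function `]a, b[ kappa)
  (hk_alpha : 0 < k_alpha) (hk_beta : k_alpha < k_beta)
  (hbounds : ae_in `]a, b[
     (fun x => forall t : R, k_alpha < kappa x t /\ kappa x t < k_beta))
  (hL0 : 0 < L0)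
  (hlip : ae_in `]a, b[
     (fun x => forall t1 t2 : R,
        `|kappa x t1 - kappa x t2| <= L0 * `|t1 - t2|))
  (f1 f2 : R -> R) (hf1 : in_L2 `]a, b[ f1) (hf2 : in_L2 `]a, b[ f2)
  (hf : ae_in `]a, b[ (fun x => f1 x <= f2 x))
  (psi_a : R) (u1 u2 : R -> R)
  (hu1 : discrete_solution a b s kappa f1 psi_a u1)
  (hu2 : discrete_solution a b s kappa f2 psi_a u2)
  (hmax : \big[Num.max/0]_(0 <= k < size s)
            `|u2 (node a b s k) - u2 (node a b s k.+1)| < 2 * k_alpha / L0) :
  forall x : R, x \in `]a, b[ -> u1 x <= u2 x.
Proof.
have sub k : (k < size s)%N ->
    `]node a b s k, node a b s k.+1[ `<=` `]a, b[.
  move=> ks x /=; rewrite !in_itv/= => /andP[kx xk].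
  rewrite (le_lt_trans _ kx) ?(lt_le_trans xk)//.
    by rewrite -{2}(node_size hs) node_le.
  by rewrite -[leLHS]/(node a b s 0) node_le// ltnW.
(* Here [j] counts the elements already treated, starting from [b]; [j = size s] reaches [a]. *)
suff comp j : (j <= size s)%N ->
    forall x, node a b s (size s - j) <= x <= b -> u1 x <= u2 x.
  move=> x; rewrite in_itv/= => /andP[ax xb].
  by apply: (comp _ (leqnn _)); rewrite subnn !ltW.
(* With no element treated, the interval is the point [b], where both solutions vanish. *)
elim: j => [_ x|j IH js x].
  rewrite subn0 (node_size hs) => /le_anti <-.
  by case: hu1 => -[_ _ ->] _; case: hu2 => -[_ _ ->].
have {}IH := IH (ltnW js).
(* The new element has index [k], and its right node [k.+1] is where the induction hypothesis begins
   to apply. *)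
set k := (size s - j.+1)%N.
have kE : (size s - j = k.+1)%N by rewrite /k -subnSK.
have ks : (k < size s)%N by rewrite -kE leq_subr.
rewrite kE in IH; move=> /andP[kx xb].
have [/ltW xk|xk] := ltP x (node a b s k.+1); last by rewrite IH// xk.
have pq := node_lt hs (leqnn k.+1) ks.
have [c1 [d1 E1]] := fe_space_affine hs ks hu1.1.
have [c2 [d2 E2]] := fe_space_affine hs ks hu2.1.
have E1' y : node a b s k < y < node a b s k.+1 -> u1 y = c1 * y + d1.
  by move=> /andP[ky yk]; rewrite E1// !ltW.
have E2' y : node a b s k < y < node a b s k.+1 -> u2 y = c2 * y + d2.
  by move=> /andP[ky yk]; rewrite E2// !ltW.
have hkappa' : caratheodory_function
    `]node a b s k, node a b s k.+1[ kappa.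
  case: hkappa => mk ck; split; last by apply: ae_in_impl ck => //; exact: sub.
  move=> t; apply: measurable_funS (mk t); last exact: sub.
  by apply: borel_lebesgue_measurable; exact: measurable_itv.
have hbounds' : ae_in `]node a b s k, node a b s k.+1[
    (fun x => forall t : R, k_alpha < kappa x t /\ kappa x t < k_beta).
  by apply: ae_in_impl hbounds => //; exact: sub.
have hlip' : ae_in `]node a b s k, node a b s k.+1[
    (fun x => forall t1 t2 : R, `|kappa x t1 - kappa x t2| <= L0 * `|t1 - t2|).
  by apply: ae_in_impl hlip => //; exact: sub.
have wq : u1 (node a b s k.+1) <= u2 (node a b s k.+1).
  by apply: IH; rewrite lexx -[leRHS](node_size hs) node_le.
have wp : u1 (node a b s k) <= u2 (node a b s k).
  apply: (element_comparison pq hkappa' hk_alpha hbounds' hL0 hlip' E1 E2);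
    rewrite ?wq//.
    apply: (element_flux_le hab hs ks hf1 hf2 hf hu1 hu2 E1' E2').
      exact: (kappa_comp_integrable pq hkappa' hk_alpha hbounds' E1').
    exact: (kappa_comp_integrable pq hkappa' hk_alpha hbounds' E2').
  apply: le_lt_trans hmax.
  apply: (@le_bigmax_seq _ _ _ _ _ k xpredT (fun k =>
    `|u2 (node a b s k) - u2 (node a b s k.+1)|)) => //.
  by rewrite mem_index_iota.
rewrite E1 ?E2 ?kx//; move: wp wq.
rewrite !(E1 (node _ _ _ _)) ?(E2 (node _ _ _ _)) ?lexx ?(ltW pq)// => wp wq.
(* Scaled by the element length, the affine difference [u2 - u1] at [x] is a combination of its two
   nonnegative nodal values with weights [x - p] and [q - x]. *)
rewrite -(@ler_pM2l _ (node a b s k.+1 - node a b s k)) ?subr_gt0// -subr_ge0.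
have -> : forall p q, (q - p) * (c2 * x + d2) - (q - p) * (c1 * x + d1) =
    (x - p) * (c2 * q + d2 - (c1 * q + d1)) +
    (q - x) * (c2 * p + d2 - (c1 * p + d1)) by move=> p q; ring.
by rewrite addr_ge0 ?mulr_ge0 ?subr_ge0.
Qed.
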